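(* Let $K$ be a prime link diagram without curls and let $i\in K_1$ be a segment. The join irreducible Kauffman states relative to $i$ (i.e. the join irreducible elements of the lattice $L(i)$ of Kauffman states relative to $i$) are precisely the states $\mathcal S(j,k)$, where $j\in K_1$ and $1\le k\le d_j=\dim T(i)_j$. Moreover, the poset isomorphism $\Phi$ from $L(i)$ to the poset of submodules of $T(i)$ maps $\mathcal S(j,k)$ to the representation $M(j,k)$, the submodule of $T(i)$ generated by $\{b_{j,1},\dots,b_{j,k}\}$.
   Context: Link diagrams. A link diagram $K$ is a projection of a link to the plane that is injective except for finitely many transversal double points (crossing points). It is regarded as a cellular decomposition of the oriented sphere $S^2$: $K_0$ is the set of crossing points (nonempty), $K_1$ the set of segments (edges; every crossing point is incident to four segments and every segment to two crossing points), $K_2$ the set of regions of the complement; $|K_1|=2|K_0|$ and $|K_2|=|K_0|+2$ (so $K$ is connected). A curl is a monogon region; $K$ is without curls if it has no monogon. ''Prime link diagram'' means: the link is prime (not the connected sum of two nontrivial links), and the diagram is prime, i.e. every simple closed curve in $S^2$ meeting $K$ transversally in exactly two points, both interior points of segments, bounds on one side a disc containing no crossing points. ''Clockwise'' is with respect to the fixed orientation of the plane. Kauffman states. Let $i\in K_1$, with adjacent regions $R_i,R_i'$. A marker is a pair $(x,R)$ with $x\in K_0$, $R\in K_2$, $x$ incident to $R$. A Kauffman state relative to $i$ is a set of markers such that each crossing point is used in exactly one marker, each region other than $R_i,R_i'$ is used in exactly one marker, and $R_i,R_i'$ are used in no marker. Let $j$ be a segment with endpoints $x,y$ and adjacent regions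 $R_1,R_2$ such that going clockwise around $x$ one passes from $R_1$ to $R_2$ when crossing $j$. A state $\mathcal S'$ is obtained from $\mathcal S$ by a counterclockwise transposition at $j$ if $\mathcal S$ contains $(x,R_2),(y,R_1)$, $\mathcal S'$ contains $(x,R_1),(y,R_2)$, and all other markers agree. Put $\mathcal S_1<\mathcal S_2$ if a (nonempty) sequence of counterclockwise transpositions transforms $\mathcal S_1$ into $\mathcal S_2$. This is a partial order with a unique minimal and a unique maximal element (Kauffman); the resulting poset $L(i)$ is a lattice. An element $c$ of a lattice is join irreducible if it is not the minimum and $c=a\vee b$ implies $c=a$ or $c=b$. The quiver $Q$. Its vertices are the segments, $Q_0=K_1$. For every crossing point with segments $a_1,a_2,a_3,a_4$ in clockwise order draw arrows $a_1\to a_2\to a_3\to a_4\to a_1$; then remove all 2-cycles. Each remaining arrow $\alpha:j\to k$ corresponds to a position $(x,R)$ in the diagram: the region $R$ at the crossing point $x$ lying between $j$ and the next segment $k$ in clockwise direction. The representation $T(i)=(T(i)_j,\phi_\alpha)$ of $Q$ over an algebraically closed field $\Bbbk$. For $j\in K_1$ let $d_j=\dim T(i)_j$ be the number of transpositions at $j$ in any sequence of counterclockwise transpositions from the minimal to the maximal Kauffman state relative to $i$ (this number does not depend on the sequence). $T(i)_j$ is the $\Bbbk$-vector space with basis $\{b_{j,1},\dots,b_{j,d_j}\}$. For every arrow $\alpha:j\to k$ one has $|d_j-d_k|\le 1$, and $\phi_\alpha:T(i)_j\to T(i)_k$ is given by: - if $d_k=d_j+1$: $\phi_\alpha(b_{j,m})=b_{k,m}$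 for all $m$; - if $d_k=d_j-1$: $\phi_\alpha(b_{j,m})=b_{k,m-1}$ for $m\ge2$ and $\phi_\alpha(b_{j,1})=0$; - if $d_k=d_j$ and the position $(x,R)$ corresponding to $\alpha$ is a marker of the minimal Kauffman state: $\phi_\alpha(b_{j,m})=b_{k,m-1}$ for $m\ge2$ and $\phi_\alpha(b_{j,1})=0$ (nilpotent Jordan block); - if $d_k=d_j$ and $(x,R)$ is not a marker of the minimal Kauffman state: $\phi_\alpha(b_{j,m})=b_{k,m}$ for all $m$ (identity). The isomorphism $\Phi$ (known from earlier work). There is an isomorphism of posets $\Phi$ from $L(i)$ to the poset of submodules of $T(i)$ ordered by inclusion, such that $\mathcal S'$ is obtained from $\mathcal S$ by a counterclockwise transposition at $j$ if and only if $M=\Phi(\mathcal S)\subset M'=\Phi(\mathcal S')$ satisfy $M'_k=M_k$ for $k\ne j$ and $\dim M'_j=\dim M_j+1$. Equivalently, $\dim\Phi(\mathcal S)_j$ is the number of transpositions at $j$ in a sequence of counterclockwise transpositions from the minimal state to $\mathcal S$. Closure. Let $S\subset T\subset K_1$. $S$ is closed in $T$ under successors (relative to $i$) if for all $s\in S$, $t\in T$ having a common endpoint $x$ such that $t$ lies between $s$ and the minimal state marker at $x$ in clockwise direction (going clockwise around $x$ from $s$, one meets $t$ before reaching the marker at $x$ of the minimal Kauffman state), one has $t\in S$. The closure of $S$ in $T$ is the smallest subset of $T$ containing $S$ that is closed in $T$ under successors. Levels. For $j\in K_1$ and $1\le k\le d_j$ define a partition $K_1=\bigsqcup_{d=0}^{k}K(d)$: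 $K(k)$ is the closure of $\{j\}$ in $K_1$; recursively for $d=k-1,\dots,1$, $K(d)$ is the closure in $K_1\setminus\bigcup_{\ell>d}K(\ell)$ of the set of all $e\in K_1\setminus\bigcup_{\ell>d}K(\ell)$ that are incident to (share an endpoint with) a segment of $K(d+1)$; and $K(0)=K_1\setminus\bigcup_{\ell>0}K(\ell)$. A segment in $K(\ell)$ is said to be at level $\ell$. The state $\mathcal S(j,k)$. It is the set of markers obtained by placing at each crossing point $x\in K_0$ the marker in the region at $x$ where the level increases in clockwise direction (the region lying between a segment and the clockwise next segment at $x$, the latter having larger level), if such a region exists; if no such region exists, all four segments at $x$ are at the same level and the marker is placed at the position of the minimal state marker at $x$. *)

(* Defs.v *)
From HB Require Import structures.
From mathcomp Require Import all_boot all_order all_algebra all_fingroup.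
From mathcomp Require Import all_classical all_reals all_analysis.

Set Implicit Arguments.
Unset Strict Implicit.
Unset Printing Implicit Defensive.

Import Order.TTheory GRing.Theory Num.Theory.
Import numFieldNormedType.Exports.

(* A dart is an end of a segment at a crossing point.  [cw] sends a dart to
   the next one clockwise around its crossing point and [flip] to the other
   end of its segment.  The dart [d] also stands for the corner between [d]
   and [cw d] at its crossing point.  With the region of that corner on the
   right, following the segment of [d] from [d] to [flip d] leads to the
   corner just before [flip d], i.e. to the corner [cw^-1 (flip d)]; hence
   the regions are the orbits of [face_perm]. *)
Definition face_perm (D : finType) (cw flip : {perm D}) : {perm D} :=
  (flip * cw^-1)%g.

(* The last two fields say that the surface glued from the regions is a
   sphere: it is connected and has Euler characteristic 2, given that
   |K_1| = 2 |K_0|.  The last one makes the set of crossing points nonempty. *)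
Record diagram := Diagram {
  dart :> finType;
  cw : {perm dart};
  flip : {perm dart};
  cw_order : forall d, #|porbit cw d| = 4;
  flip_order : forall d, #|porbit flip d| = 2;
  diagram_connected : forall d d',
    connect (fun a b => (b == cw a) || (b == flip a)) d d';
  diagram_sphere : #|porbits (face_perm cw flip)| = #|porbits cw| + 2
}.
Arguments cw {_}.
Arguments flip {_}.

Definition face (K : diagram) : {perm K} := face_perm cw flip.
Arguments face {_}.

Definition orbit_type (D : finType) (s : {perm D}) : Type :=
  {A : {set D} | A \in porbits s}.
HB.instance Definition _ (D : finType) (s : {perm D}) :=
  SubFinite.on (orbit_type s).

Definition orbit_of (D : finType) (s : {perm D}) (d : D) : orbit_type s :=
  exist _ (porbit s d) (imset_f (porbit s) (isT : d \in D)).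

Notation crossing K := (orbit_type (@cw K)).
Notation segment K := (orbit_type (@flip K)).
Notation region K := (orbit_type (@face K)).

Definition cr (K : diagram) (d : K) : crossing K := orbit_of cw d.
Definition sg (K : diagram) (d : K) : segment K := orbit_of flip d.
(* The region of the corner [d]; the two regions adjacent to the segment of
   [d] are [rg d] and [rg (flip d)]. *)
Definition rg (K : diagram) (d : K) : region K := orbit_of face d.

Definition incident (K : diagram) (x : crossing K) (r : region K) : bool :=
  [exists d : K, (cr d == x) && (rg d == r)].

Definition adjacent (K : diagram) (e : segment K) (r : region K) : bool :=
  [exists d : K, (sg d == e) && (rg d == r)].

Definition share_endpoint (K : diagram) (e f : segment K) : bool :=
  [exists a : K, exists b : K, [&& sg a == e, sg b == f & cr a == cr b]].

Definition without_curls (K : diagram) : Prop :=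
  forall r : region K, #|val r| <> 1.

(* A simple closed curve meeting the diagram transversally in two points, both
   interior to segments, leaves the region [rg d] through the segment of [d],
   enters [rg (flip d)], and comes back through the segment of [d'] (possibly
   the same segment). *)
Definition two_point_curve (K : diagram) (d d' : K) : Prop :=
  rg d' = rg (flip d) /\ rg (flip d') = rg d.

(* Two crossing points are on the same side of that curve when the diagram
   contains a path between them that does not use the segments it crosses. *)
Definition same_side (K : diagram) (d d' : K) : rel (crossing K) :=
  connect (fun x y => [exists a : K,
    [&& cr a == x, cr (flip a) == y, sg a != sg d & sg a != sg d']]).

(* One side of each such curve contains no crossing point, i.e. all crossing
   points are on the other one. *)
Definition prime_diagram (K : diagram) : Prop :=
  forall d d' : K, two_point_curve d d' ->
  forall x y : crossing K, same_side d d' x y.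

Section Links.
Local Open Scope classical_set_scope.
Local Open Scope ring_scope.
Variable R : realType.
Notation space := 'rV[R]_3.

Definition cx (p : space) : R := p 0 0.
Definition cy (p : space) : R := p 0 1.
Definition cz (p : space) : R := p 0 2%:R.

(* A link with [n] components, each parametrized by R/Z: a C^1 embedding. *)
Record link_embedding (n : nat) (gam : 'I_n -> R -> space) : Prop := {
  link_periodic : forall c t, gam c (t + 1) = gam c t;
  link_derivable : forall c t, derivable (gam c) t 1;
  link_C1 : forall c, continuous (derive1 (gam c));
  link_immersed : forall c t, derive1 (gam c) t != 0;
  link_injective : forall c c' s t, gam c s = gam c' t ->
    c = c' /\ exists z : int, s = t + z%:~R
}.

Definition link_set (n : nat) (gam : 'I_n -> R -> space) : set space :=
  [set p | exists c t, p = gam c t].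

Definition is_link (L : set space) : Prop :=
  exists n (gam : 'I_n -> R -> space), link_embedding gam /\ L = link_set gam.

Definition isotopic (A B : set space) : Prop :=
  exists H : R * space -> space,
    [/\ continuous H,
        forall t, exists g : space -> space,
          [/\ continuous g, cancel (fun p => H (t, p)) g
            & cancel g (fun p => H (t, p))],
        forall p, H (0, p) = p
      & (fun p => H (1, p)) @` A = B].

(* Links lying in a plane are unlinks. *)
Definition trivial_link (L : set space) : Prop :=
  is_link L /\
  exists L', [/\ is_link L', isotopic L L' & L' `<=` [set p | cz p = 0]].

Definition chord (p q : space) : set space :=
  [set r | exists t : R, 0 <= t <= 1 /\ r = (1 - t) *: p + t *: q].

(* [L] is isotopic to a link that meets the plane x = 0 transversally in exactly
   two points p and q, and [L1], [L2] are obtained from its two halves by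
   joining p and q in the plane. *)
Definition connected_sum (L L1 L2 : set space) : Prop :=
  exists n (gam : 'I_n -> R -> space) (p q : space),
    [/\ link_embedding gam, isotopic L (link_set gam) &
        [/\ forall c t, cx (gam c t) = 0 -> cx (derive1 (gam c) t) != 0,
            p <> q,
            link_set gam `&` [set r | cx r = 0] = [set p; q],
            isotopic L1
              ((link_set gam `&` [set r | cx r <= 0]) `|` chord p q)
          & isotopic L2
              ((link_set gam `&` [set r | 0 <= cx r]) `|` chord p q)]].

Definition prime_link (L : set space) : Prop :=
  is_link L /\
  forall L1 L2 : set space, is_link L1 -> is_link L2 ->
    connected_sum L L1 L2 -> trivial_link L1 \/ trivial_link L2.

Definition proj (p : space) : R * R := (cx p, cy p).

(* [K] is the diagram obtained by projecting the link [gam] to the xy-plane.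
   The dart [d] starts at the point of the component [comp d] with parameter
   [time d], lying over a double point, and runs forwards or backwards according
   to [fwd d]. *)
Record projects_to (n : nat) (gam : 'I_n -> R -> space) (K : diagram)
    (comp : K -> 'I_n) (time : K -> R) (fwd : K -> bool) : Prop := {
  proj_immersed : forall c t, proj (derive1 (gam c) t) != (0, 0);
  proj_time : forall d, 0 <= time d < 1;
  proj_double : forall c t b, 0 <= t < 1 ->
    ((exists c' t', [/\ 0 <= t' < 1, (c', t') <> (c, t)
                      & proj (gam c' t') = proj (gam c t)])
     <-> exists d, [/\ comp d = c, time d = t & fwd d = b]);
  proj_inj : forall d d',
    comp d = comp d' -> time d = time d' -> fwd d = fwd d' -> d = d';
  proj_crossing : forall d d',
    proj (gam (comp d) (time d)) = proj (gam (comp d') (time d'))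
    <-> cr d = cr d';
  proj_opposite : forall d,
    [/\ comp (cw (cw d)) = comp d, time (cw (cw d)) = time d
      & fwd (cw (cw d)) = ~~ fwd d];
  (* the direction of [cw d] is on the right of that of [d]; in particular
     double points are transversal *)
  proj_clockwise : forall d,
    let u := (-1) ^+ (~~ fwd d) *: derive1 (gam (comp d)) (time d) in
    let v := (-1) ^+ (~~ fwd (cw d)) *:
               derive1 (gam (comp (cw d))) (time (cw d)) in
    cx u * cy v - cy u * cx v < 0;
  (* [flip d] is at the next double point along the component *)
  proj_flip : forall d, comp (flip d) = comp d /\ fwd (flip d) = ~~ fwd d;
  proj_next : forall d, fwd d ->
    exists s, [/\ time d < s, s = time (flip d) \/ s = time (flip d) + 1
      & forall a, comp a = comp d ->
          ~ (time d < time a < s) /\ ~ (time d < time a + 1 < s)];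
  proj_cellular : forall c, exists d, comp d = c
}.

Definition is_diagram_of (n : nat) (gam : 'I_n -> R -> space)
    (K : diagram) : Prop :=
  exists (comp : K -> 'I_n) (time : K -> R) (fwd : K -> bool),
    projects_to gam comp time fwd.

End Links.

Section States.
Variables (K : diagram) (i : segment K).

Notation marker := (crossing K * region K)%type.

Definition is_state (S : {set marker}) : bool :=
  [&& [forall m in S, incident m.1 m.2],
      [forall x : crossing K, #|[set m in S | m.1 == x]| == 1] &
      [forall r : region K,
         #|[set m in S | m.2 == r]| == (if adjacent i r then 0 else 1)]].

Definition state := {S : {set marker} | is_state S}.
HB.instance Definition _ := SubFinite.on state.

(* Counterclockwise transposition at [j].  If the dart [d] of [j] is at [x],
   then crossing [j] clockwise around [x] leads from [R1 = rg (flip d)] to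
   [R2 = rg d]. *)
Definition transposition (j : segment K) (S S' : state) : bool :=
  [exists d : K,
    let x := cr d in let y := cr (flip d) in
    let R1 := rg (flip d) in let R2 := rg d in
    [&& sg d == j,
        ((x, R2) \in val S) && ((y, R1) \in val S),
        ((x, R1) \in val S') && ((y, R2) \in val S') &
        val S :\: [set (x, R2); (y, R1)]%SET
          == val S' :\: [set (x, R1); (y, R2)]%SET]].

Definition state_le : rel state :=
  connect (fun S S' => [exists j, transposition j S S']).

Definition is_min (S : state) : bool := [forall S', state_le S S'].
Definition is_max (S : state) : bool := [forall S', state_le S' S].

Definition is_join (a b c : state) : Prop :=
  [/\ state_le a c, state_le b c
    & forall c', state_le a c' -> state_le b c' -> state_le c c'].

Definition join_irreducible (c : state) : Prop :=
  ~~ is_min c /\ forall a b, is_join a b c -> c = a \/ c = b.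

(* [js] lists the segments of a sequence of transpositions from [S] to [S']. *)
Fixpoint transposition_seq (S : state) (js : seq (segment K)) (S' : state)
    : bool :=
  if js is j :: js' then
    [exists S1, transposition j S S1 && transposition_seq S1 js' S']
  else S == S'.

Definition min_to_max (js : seq (segment K)) : Prop :=
  exists S0 S1, [/\ is_min S0, is_max S1 & transposition_seq S0 js S1].

(* The number of transpositions at [j] does not depend on the sequence from the
   minimal to the maximal state, so we choose one with [xget]. *)
Definition dimT (j : segment K) : nat :=
  count_mem j (xget [::] min_to_max).

Definition min_marker (d : K) : bool :=
  [exists S : state, is_min S && ((cr d, rg d) \in val S)].

(* Going clockwise from [s] around a common endpoint, one meets [t] before the
   marker of the minimal state: none of the corners passed on the way from the
   dart [a] of [s] to the dart [iter n cw a] of [t] carries it. *)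
Definition successor (s t : segment K) : bool :=
  [exists a : K, exists n : 'I_4,
    [&& sg a == s, sg (iter n cw a) == t
      & [forall m : 'I_n, ~~ min_marker (iter m cw a)]]].

Definition closed_in (T S : {set segment K}) : bool :=
  (S \subset T) &&
  [forall s in S, forall t in T, successor s t ==> (t \in S)].

Definition closure_in (T S : {set segment K}) : {set segment K} :=
  (\bigcap_(C : {set segment K} | closed_in T C && (S \subset C)) C)%SET.

(* [level_rec j n] is the pair of K(k - n) and of the union of the K(l) with
   k - n <= l <= k; it does not depend on k. *)
Fixpoint level_rec (j : segment K) (n : nat)
    : {set segment K} * {set segment K} :=
  if n is n'.+1 then
    let: (C, U) := level_rec j n' in
    let C' := closure_in (~: U)
      [set e in ~: U | [exists f in C, share_endpoint e f]]%SET in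
    (C', U :|: C')
  else
    let C := closure_in [set: segment K]%SET [set j]%SET in (C, C).

Definition level_set (j : segment K) (k d : nat) : {set segment K} :=
  if d == 0 then ~: (level_rec j k.-1).2 else (level_rec j (k - d)).1.

Definition level (j : segment K) (k : nat) (e : segment K) : nat :=
  if [pick d : 'I_k.+1 | e \in level_set j k d] is Some d then d else 0.

Definition level_increases (j : segment K) (k : nat) (d : K) : bool :=
  level j k (sg d) < level j k (sg (cw d)).

Definition stateS (j : segment K) (k : nat) : {set marker} :=
  [set (cr d, rg d) | d : K &
     level_increases j k d ||
     ([forall d' : K, (cr d' == cr d) ==> ~~ level_increases j k d']
      && min_marker d)]%SET.

(* The corner [d] gives an arrow from [sg d] to [sg (cw d)]; it belongs to Q
   unless it lies on a 2-cycle.  (For a prime diagram without curls an arrow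
   lies on at most one 2-cycle, so no multiplicities are involved.) *)
Definition is_arrow (d : K) : bool :=
  ~~ [exists d' : K, (sg d' == sg (cw d)) && (sg (cw d') == sg d)].

Variable F : closedFieldType.
Local Open Scope ring_scope.

(* Vectors are rows, linear maps act by right multiplication, and the basis
   vector b_(j,m+1) is [basisT j m]. *)
Definition spaceT (j : segment K) := 'rV[F]_(dimT j).

Definition basisT (j : segment K) (m : 'I_(dimT j)) : spaceT j :=
  delta_mx 0 m.

Definition phi (d : K) : 'M[F]_(dimT (sg d), dimT (sg (cw d))) :=
  let dj := dimT (sg d) in let dk := dimT (sg (cw d)) in
  if (dk == dj.+1) || ((dk == dj) && ~~ min_marker d) then
    \matrix_(m, n) (m == n :> nat)%:R
  else if (dj == dk.+1) || ((dk == dj) && min_marker d) then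
    \matrix_(m, n) (m == n.+1 :> nat)%:R
  else 0. (* |dj - dk| > 1, which does not occur *)

Definition subspaces := forall j : segment K, {vspace spaceT j}.

Definition submodule (M : subspaces) : Prop :=
  forall d : K, is_arrow d ->
  forall v : spaceT (sg d), v \in M (sg d) ->
    (v *m phi d : spaceT (sg (cw d))) \in M (sg (cw d)).

Definition subspaces_le (M N : subspaces) : Prop := forall j, (M j <= N j)%VS.

(* M(j,k), as the smallest submodule containing b_(j,1), ..., b_(j,k). *)
Definition is_generated (j : segment K) (k : nat) (M : subspaces) : Prop :=
  [/\ submodule M,
      forall m : 'I_(dimT j), (m < k)%N -> basisT m \in M j
    & forall N : subspaces, submodule N ->
        (forall m : 'I_(dimT j), (m < k)%N -> basisT m \in N j) ->
        subspaces_le M N].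

Record state_module_iso (Phi : state -> subspaces) : Prop := {
  Phi_submodule : forall S, submodule (Phi S);
  Phi_le : forall S S', state_le S S' <-> subspaces_le (Phi S) (Phi S');
  Phi_injective : forall S S', (forall e, Phi S e = Phi S' e) -> S = S';
  Phi_surjective : forall M, submodule M ->
    exists S, forall e, Phi S e = M e;
  Phi_transposition : forall j S S', transposition j S S' <->
    [/\ subspaces_le (Phi S) (Phi S'),
        forall e, e <> j -> Phi S' e = Phi S e
      & \dim (Phi S' j) = (\dim (Phi S j)).+1]
}.

End States.

(* Main.v *)
From HB Require Import structures.
Require Import Defs.
From mathcomp Require Import all_boot all_order all_algebra all_fingroup all_reals.

Set Implicit Arguments.
Unset Strict Implicit.
Unset Printing Implicit Defensive.

Import Order.TTheory GRing.Theory.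

(* A state is encoded by its height function, the dimension vector of the
   corresponding submodule: around a crossing point, the marker sits where the
   height increases clockwise, or at the minimal marker if there is no such
   place.  Since the diagram is prime and has no curls, the four corners at a
   crossing point lie in distinct regions; hence height functions are local: a
   height decreases clockwise only across a minimal marker, and then by at most
   one.  Conversely, every local function bounded by the dimensions of T(i) is
   the height of a state, because the initial segments of the bases that it
   describes form a submodule.  So states and submodules are both the bounded
   local functions, with pointwise order and pointwise maxima as joins.  The
   level function of (j, k) is the least local function with value at least k
   at j: this makes its submodule the one generated by b_1, ..., b_k at j, makes
   it join irreducible, and makes every local function h the maximum of the level
   functions of the pairs (j, h j). *)

(** * Orbits of a permutation as a finite type *)

Section Orbits.
Variables (D : finType) (s : {perm D}).
Implicit Types d : D.

Lemma orbit_of_eq d d' : (orbit_of s d == orbit_of s d') = (d \in porbit s d').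
Proof. by rewrite -val_eqE /= eq_porbit_mem. Qed.

Lemma orbit_of_perm d : orbit_of s (s d) = orbit_of s d.
Proof. by apply/eqP; rewrite orbit_of_eq (mem_porbit s 1). Qed.

Lemma orbit_of_permV d : orbit_of s ((s^-1)%g d) = orbit_of s d.
Proof. by rewrite -{2}(permKV s d) orbit_of_perm. Qed.

Lemma orbit_of_iter n d : orbit_of s (iter n s d) = orbit_of s d.
Proof. by elim: n => //= n <-; rewrite orbit_of_perm. Qed.

Lemma orbit_of_surj (x : orbit_type s) : exists d, x = orbit_of s d.
Proof.
case/imsetP: (valP x) => d _ xE; exists d; exact: val_inj.
Qed.

Lemma orbit_of_iterP d d' :
  orbit_of s d' = orbit_of s d -> exists2 n, n < #|porbit s d| & d' = iter n s d.
Proof.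
move/eqP; rewrite orbit_of_eq porbit_traject => /trajectP[n lt_n ->].
by exists n.
Qed.

Lemma card_orbit_type : #|{: orbit_type s}| = #|porbits s|.
Proof. by rewrite card_sig; apply: eq_card. Qed.

Lemma card_uniform_orbits n :
  (forall d, #|porbit s d| = n) -> #|D| = #|{: orbit_type s}| * n.
Proof.
move=> card_s; rewrite -sum1_card (partition_big (orbit_of s) predT) //=.
rewrite -sum_nat_const; apply: eq_bigr => x _.
have [d ->] := orbit_of_surj x.
by rewrite -(card_s d) -sum1_card; apply: eq_bigl => d'; rewrite orbit_of_eq.
Qed.

End Orbits.

(** * Planarity of diagrams *)

Section Diagrams.
Variable K : diagram.
Implicit Types (d a : K) (x y : crossing K) (r : region K).

Lemma flipK : involutive (@flip K).
Proof. by move=> d; have := iter_porbit flip d; rewrite flip_order. Qed.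

Lemma flip_neq d : flip d != d.
Proof.
have := uniq_traject_porbit flip d.
by rewrite flip_order /= inE andbT eq_sym.
Qed.

Lemma cw4 d : cw (cw (cw (cw d))) = d.
Proof. by have := iter_porbit cw d; rewrite cw_order. Qed.

Lemma cw_uniq d : uniq [:: d; cw d; cw (cw d); cw (cw (cw d))].
Proof. by have := uniq_traject_porbit cw d; rewrite cw_order. Qed.

Lemma cr_cw d : cr (cw d) = cr d. Proof. exact: orbit_of_perm. Qed.
Lemma cr_iter n d : cr (iter n cw d) = cr d. Proof. exact: orbit_of_iter. Qed.
Lemma sg_flip d : sg (flip d) = sg d. Proof. exact: orbit_of_perm. Qed.

Lemma cr_iterP d d' : cr d' = cr d -> exists2 n, n < 4 & d' = iter n cw d.
Proof. by case/orbit_of_iterP=> n; rewrite cw_order; exists n. Qed.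

Lemma sgP d d' : sg d' = sg d -> d' = d \/ d' = flip d.
Proof.
case/orbit_of_iterP=> n; rewrite flip_order.
by case: n => [|[|//]] _ ->; [left|right].
Qed.

Lemma faceE d : face d = (cw^-1)%g (flip d).
Proof. by rewrite /face /face_perm permM. Qed.

Lemma rg_flip_cw d : rg (flip (cw d)) = rg d.
Proof. by rewrite /rg -orbit_of_perm faceE flipK permK. Qed.

Lemma rg_cwV d : rg ((cw^-1)%g d) = rg (flip d).
Proof. by rewrite -rg_flip_cw permKV. Qed.

(** * Cellular chains in characteristic two *)

Section Chains.
Local Open Scope ring_scope.
Variables (F : fieldType) (pchar2 : 2%N \in [pchar F]).
Notation chain T := {ffun T -> F^o}.

Definition coboundary (p : chain (region K)) : chain (segment K) :=
  [ffun e => \sum_(d | sg d == e) p (rg d)].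

Definition boundary (z : chain (segment K)) : chain (crossing K) :=
  [ffun x => \sum_(d | cr d == x) z (sg d)].

Fact coboundary_is_linear : linear coboundary.
Proof.
move=> a p q; apply/ffunP=> e; rewrite !ffunE scaler_sumr -big_split.
by apply: eq_bigr => d _; rewrite !ffunE.
Qed.
HB.instance Definition _ :=
  GRing.isLinear.Build _ _ _ _ coboundary coboundary_is_linear.

Fact boundary_is_linear : linear boundary.
Proof.
move=> a p q; apply/ffunP=> e; rewrite !ffunE scaler_sumr -big_split.
by apply: eq_bigr => d _; rewrite !ffunE.
Qed.
HB.instance Definition _ :=
  GRing.isLinear.Build _ _ _ _ boundary boundary_is_linear.

Let addrr2 (a : F^o) : a + a = 0.
Proof. exact: addrr_pchar2. Qed.

Lemma coboundary_sg (p : chain (region K)) d :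
  coboundary p (sg d) = p (rg d) + p (rg (flip d)).
Proof.
rewrite ffunE (bigD1 d) //= (bigD1 (flip d)) /=; last first.
  by rewrite sg_flip eqxx flip_neq.
by rewrite big1 ?addr0 // => d' /andP[/andP[/eqP /sgP[]->]]; rewrite eqxx.
Qed.

Lemma boundary_coboundary p : boundary (coboundary p) = 0.
Proof.
apply/ffunP=> x; rewrite ffunE [RHS]ffunE.
under eq_bigr do rewrite coboundary_sg.
(* Each corner at [x] is counted by the two darts bounding it, so the two sums agree and cancel. *)
rewrite big_split /= [X in _ + X](reindex_inj (@perm_inj _ cw)) /=.
rewrite [X in _ + X](eq_big (fun d => cr d == x) (fun d => p (rg d))).
- exact: addrr2.
- by move=> d; rewrite cr_cw.
- by move=> d _; rewrite rg_flip_cw.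
Qed.

Lemma dim_chain (T : finType) : \dim {: chain T} = #|T|.
Proof. by rewrite dimvf; exact: muln1. Qed.

Definition point (T : finType) (t : T) : chain T := [ffun t' => (t' == t)%:R].

Lemma point_sum (T : finType) (z : chain T) : z = \sum_t z t *: point t.
Proof.
apply/ffunP=> t; rewrite sum_ffunE (bigD1 t) //= !ffunE eqxx /=.
rewrite big1 ?addr0; first by rewrite /GRing.scale /= mulr1.
by move=> t' /negPf ne; rewrite !ffunE eq_sym ne /GRing.scale /= mulr0.
Qed.

(** Such a [p] agrees on both sides of every segment, hence at neighbouring corners; connectedness
    does the rest. *)
Lemma coboundary_ker p :
  coboundary p = 0 -> exists c, forall r, p r = c.
Proof.
move=> p0; have flip_p d : p (rg (flip d)) = p (rg d).
  have /ffunP/(_ (sg d)) := p0; rewrite coboundary_sg ffunE => /eqP.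
  by rewrite addr_eq0 => /eqP->; apply/eqP; rewrite -addr_eq0 addrr2.
have cw_p d : p (rg (cw d)) = p (rg d) by rewrite -flip_p rg_flip_cw.
case: (pickP (@predT (region K))) => [r0 _|none]; last first.
  by exists 0 => r; have := none r.
have [d0 r0E] := orbit_of_surj r0; exists (p (rg d0)) => r.
have [d ->] := orbit_of_surj r.
have /connectP[q path_q ->] := diagram_connected d0 d.
elim: q d0 path_q {r0E} => //= d1 q IHq d0 /andP[/orP[]/eqP-> /IHq->] //.
Qed.

Let pointDD (T : finType) (t : T) : point t + point t = 0.
Proof. by apply/ffunP=> u; rewrite !ffunE addrr2. Qed.

Let boundaryD z w : boundary (z + w) = boundary z + boundary w.
Proof. exact: linearD. Qed.

Definition step (P : pred (segment K)) : rel (crossing K) := fun x y =>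
  [exists a : K, [&& cr a == x, cr (flip a) == y & P (sg a)]].

Lemma boundary_sg d : boundary (point (sg d)) = point (cr d) + point (cr (flip d)).
Proof.
apply/ffunP=> x; rewrite !ffunE big_mkcond /= (bigD1 d) //= !ffunE eqxx.
rewrite (bigD1 (flip d)) ?flip_neq //= !ffunE sg_flip eqxx.
rewrite big1 ?addr0; last first.
  move=> a /andP[ne1 ne2]; rewrite !ffunE.
  case: (sg a =P sg d) => [/sgP[]e|_]; last by rewrite if_same.
    by rewrite e eqxx in ne1.
  by rewrite e eqxx in ne2.
by rewrite !(eq_sym x); do 2!case: (_ == x).
Qed.

(** In the sum of the segments of a path, the interior crossing points cancel in pairs. *)
Lemma chain_of_path (P : pred (segment K)) x y :
  connect (step P) x y ->
  exists2 z : chain (segment K), boundary z = point x + point y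
    & forall e, ~~ P e -> z e = 0.
Proof.
case/connectP=> q path_q ->; elim: q x path_q => [|w q IHq] x /=.
  by exists 0 => [|e _]; rewrite ?linear0 ?pointDD ?ffunE.
case/andP=> /existsP[a /and3P[/eqP<- /eqP<- Pa]] /IHq[z zE zP].
exists (point (sg a) + z) => [|e Pe].
  rewrite boundaryD zE boundary_sg -addrA; congr (_ + _).
  by rewrite addrA pointDD add0r.
by rewrite !ffunE zP // addr0; case: eqP => // ee; rewrite ee Pa in Pe.
Qed.

Lemma crossing_connected x y : connect (step predT) x y.
Proof.
have [[d ->] [d' ->]] := (orbit_of_surj x, orbit_of_surj y).
have /connectP[q path_q ->] := diagram_connected d d'.
elim: q d path_q => //= d1 q IHq d /andP[/orP[]/eqP-> /IHq]; rewrite -/(cr _).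
  by rewrite cr_cw.
apply: connect_trans; apply: connect1; apply/existsP; exists d.
by rewrite /= !eqxx.
Qed.

(** The first homology of the sphere vanishes: with V crossing points, 2V segments and V + 2
    regions, the cycles and the boundaries of regions both have dimension V + 1. *)
Lemma cycle_coboundary z : boundary z = 0 -> exists p, z = coboundary p.
Proof.
move=> z0; pose B := linfun boundary; pose C := linfun coboundary.
have im_sub : (limg C <= lker B)%VS.
  apply/subvP=> _ /memv_imgP[p _ ->].
  by rewrite memv_ker !lfunE /= boundary_coboundary.
have dimC : (#|{: region K}| <= (\dim (limg C)).+1)%N.
  rewrite -dim_chain -(limg_ker_dim C fullv) capfv addnC -addn1 leq_add2l.
  rewrite (leq_trans (dimvS _) (dim_span [:: [ffun=> 1] : chain _])) //.
  apply/subvP=> p; rewrite memv_ker lfunE /= => /eqP/coboundary_ker[c pc].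
  rewrite span_seq1; apply/vlineP; exists c; apply/ffunP=> r.
  by rewrite !ffunE pc /GRing.scale /= mulr1.
(* Modulo boundaries, connectedness makes every point equivalent to [x0]. *)
have dimB : (#|{: crossing K}| <= (\dim (limg B)).+1)%N.
  case: (pickP (@predT (crossing K))) => [x0 _|none]; last first.
    by rewrite eq_card0.
  rewrite -dim_chain.
  apply: (@leq_trans (\dim (limg B + <[point x0]>))); last first.
    apply: leq_trans (dimv_add_leqif _ _) _.
    by rewrite -addn1 leq_add2l dim_vline leq_b1.
  apply/dimvS/subvP=> w _; rewrite (point_sum w); apply: memv_suml => y _.
  apply: memvZ.
  have [b bE _] := chain_of_path (crossing_connected y x0).
  have -> : point y = boundary b + point x0.
    by rewrite bE -addrA pointDD addr0.
  by rewrite memv_add ?memv_line // -(lfunE boundary) memv_img ?memvf.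
have cardE : (#|{: segment K}| = #|{: crossing K}| * 2)%N.
  apply/eqP; rewrite -(@eqn_pmul2r 2) // -mulnA.
  by rewrite -(card_uniform_orbits (@flip_order K)) -(card_uniform_orbits (@cw_order K)).
have : (lker B == limg C).
  rewrite eq_sym eqEdim im_sub /=.
  have := limg_ker_dim B fullv; rewrite capfv dim_chain cardE.
  have := diagram_sphere K; rewrite -(card_orbit_type cw).
  rewrite -(card_orbit_type (face_perm cw flip)) => F_eq.
  move: dimC dimB; rewrite {1}/face F_eq.
  move: (#|{: crossing K}|) (\dim _) (\dim _) (\dim _) => v c b k.
  rewrite addn2 ltnS muln2 -addnn => vc vb kb.
  rewrite -(leq_add2r b) kb.
  by rewrite (leq_trans (leq_add (leqnn v) vb)) // addnS -addSn leq_add2r.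
move/eqP=> kerE; have : z \in lker B by rewrite memv_ker lfunE /= z0.
by rewrite kerE => /memv_imgP[p _ ->]; exists p; rewrite lfunE.
Qed.

(* Two segments separating the same two regions form a cut, because a path
   joining the ends of one of them without using either closes up to a cycle,
   which must be the boundary of a union of regions. *)
Lemma two_segment_cut_in d d' : sg d != sg d' \/ rg d = rg (flip d) ->
  two_point_curve d d' -> ~~ same_side d d' (cr d) (cr (flip d)).
Proof.
move=> neq [rg1 rg2]; apply/negP.
pose P := [pred e | (e != sg d) && (e != sg d')].
rewrite /same_side (eq_connect (e' := step P)) //.
case/chain_of_path=> z zE zP.
have /cycle_coboundary[p pE] : boundary (point (sg d) + z) = 0.
  by rewrite boundaryD zE boundary_sg; apply/ffunP=> u; rewrite !ffunE addrr2.
(* The cycle has coefficient 1 at the segment of [d]. If that segment has one region on both sides,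
   the coboundary is 0 there; if the segments differ, it takes the same value at that of [d'], where
   the cycle has coefficient 0. *)
have /ffunP/(_ (sg d)) := pE.
rewrite coboundary_sg !ffunE eqxx zP ?inE ?eqxx // addr0.
case: neq => [neq|<-]; last by rewrite addrr2 => /eqP; rewrite oner_eq0.
have /ffunP/(_ (sg d')) := pE.
rewrite coboundary_sg !ffunE eq_sym (negPf neq) zP ?inE ?eqxx ?andbF //.
by rewrite rg1 rg2 addr0 [RHS]addrC => <- /eqP; rewrite oner_eq0.
Qed.

End Chains.

Lemma two_segment_cut d d' : sg d != sg d' \/ rg d = rg (flip d) ->
  two_point_curve d d' -> ~~ same_side d d' (cr d) (cr (flip d)).
Proof. exact: (two_segment_cut_in (pchar_Fp (isT : prime 2))). Qed.

End Diagrams.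

(** * Corners and segments at a crossing point *)

Section PrimeDiagrams.
Variable K : diagram.
Hypotheses (prime_K : prime_diagram K) (curls_K : without_curls K).
Implicit Types d a : K.

Lemma face_neq d : face d != d.
Proof.
apply/eqP=> fix_d; apply: (curls_K (r := rg d)); apply/eqP/cards1P; exists d.
apply/setP=> a; rewrite inE; apply/idP/eqP=> [/porbitP[n ->]|->]; last first.
  exact: porbit_id.
by rewrite permX; elim: n => //= n ->.
Qed.

(** Otherwise a closed curve crossing only this segment, encoded by taking [d] twice, would separate
    its two ends. *)
Lemma rg_flip_neq d : rg d <> rg (flip d).
Proof.
move=> e; have curve : two_point_curve d d by [].
by have := two_segment_cut (or_intror e) curve; rewrite prime_K.
Qed.

Lemma rg_cw_neq d : rg (cw d) <> rg d.
Proof. by move=> e; apply: (@rg_flip_neq (cw d)); rewrite rg_flip_cw. Qed.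

(** Otherwise the segments of [cw d] and [cw (cw d)] would separate the same two regions; primeness
    excludes this unless they are one segment, which then bounds a curl. *)
Lemma rg_cw2_neq d : rg (cw (cw d)) <> rg d.
Proof.
move=> e.
have curve : two_point_curve (cw d) (cw (cw d)) by rewrite /two_point_curve !rg_flip_cw.
suff neq : sg (cw d) != sg (cw (cw d)).
  by have := two_segment_cut (or_introl neq) curve; rewrite prime_K.
apply/eqP=> /esym/sgP[/perm_inj eq|eq].
  by have := cw_uniq d; rewrite eq /= inE eqxx.
by have := face_neq (cw d); rewrite faceE -eq permK eqxx.
Qed.

(** This identifies markers with corners, that is, with darts. *)
Lemma corner_inj d d' : cr d = cr d' -> rg d = rg d' -> d = d'.
Proof.
case/cr_iterP=> n; case: n => [|[|[|[|//]]]] _ -> //=.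
- by move/rg_cw_neq.
- by move/rg_cw2_neq.
- by move/esym; rewrite -{1}(cw4 d') => /rg_cw_neq.
Qed.

(** No segment is a loop: neighbouring ends would enclose a curl, and opposite ends would put two
    neighbouring corners in one region. *)
Lemma sg_inj_at_crossing d d' : cr d = cr d' -> sg d = sg d' -> d = d'.
Proof.
move=> eq_cr /sgP[//|eq_flip].
have neq1 a : flip a <> cw a.
  by move=> e; have := face_neq a; rewrite faceE e permK eqxx.
case/cr_iterP: eq_cr => n; case: n => [|[|[|[|//]]]] _ // eq_cw; case/esym: eq_cw.
- by rewrite eq_flip => /esym /neq1.
- rewrite eq_flip /= => e2; have := @rg_cw_neq d'.
  by rewrite -(rg_flip_cw (cw d')) e2 flipK.
- rewrite eq_flip /= => e3; case: (neq1 (flip d')).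
  by rewrite flipK -e3 cw4.
Qed.

End PrimeDiagrams.

(** * Markers and heights of Kauffman states *)

Definition ccw {K : diagram} : {perm K} := (cw^-1)%g.

Section Counterclockwise.
Variable K : diagram.
Implicit Types d m : K.

Lemma cwK d : ccw (cw d) = d. Proof. exact: permK. Qed.
Lemma ccwK d : cw (ccw d) = d. Proof. exact: permKV. Qed.

Lemma cr_ccw d : cr (ccw d) = cr d. Proof. exact: orbit_of_permV. Qed.

Lemma cr_iter_ccw n d : cr (iter n ccw d) = cr d.
Proof. by elim: n => //= n <-; rewrite cr_ccw. Qed.

Lemma ccw4 d : ccw (ccw (ccw (ccw d))) = d.
Proof. by rewrite -{1}(cw4 d) !cwK. Qed.

Lemma cw_ccw3 d : cw d = iter 3 ccw d.
Proof. by rewrite -{1}(ccw4 d) ccwK. Qed.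

Lemma cr_ccwP m d : cr d = cr m -> exists2 n, n < 4 & d = iter n ccw m.
Proof.
move/eqP; rewrite orbit_of_eq -porbitV porbit_traject porbitV cw_order.
by case/trajectP=> n n4 ->; exists n.
Qed.

Lemma iter_ccw_inj m s t :
  s < 4 -> t < 4 -> (iter s ccw m == iter t ccw m) = (s == t).
Proof.
move=> s4 t4; have := uniq_traject_porbit ccw m.
rewrite porbitV cw_order => /(nth_uniq m); rewrite size_traject.
by move/(_ s t s4 t4); rewrite !nth_traject.
Qed.

End Counterclockwise.

Section States.
Variables (K : diagram) (i : segment K).
Hypotheses (prime_K : prime_diagram K) (curls_K : without_curls K).
Implicit Types (S : state i) (d a m : K) (h : segment K -> nat).

Definition has_marker S d : bool := (cr d, rg d) \in val S.

Lemma has_marker_inj S d d' :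
  has_marker S d -> has_marker S d' -> cr d = cr d' -> d = d'.
Proof.
move=> Sd Sd' eq_cr; apply: corner_inj => //.
case/and3P: (valP S) => _ /forallP/(_ (cr d))/cards1P[u uE] _.
have: (cr d, rg d) \in [set u] by rewrite -uE inE eqxx andbT.
have: (cr d', rg d') \in [set u] by rewrite -uE inE eq_cr eqxx andbT.
by rewrite !inE => /eqP<- /eqP/(congr1 snd).
Qed.

Lemma has_marker_exists S d : exists2 m, cr m = cr d & has_marker S m.
Proof.
case/and3P: (valP S) => /forall_inP S_inc /forallP/(_ (cr d))/cards1P[u uE] _.
have : u \in [set u] by rewrite inE.
rewrite -uE inE => /andP[Su /eqP <-].
have /existsP[m /andP[/eqP cr_m /eqP rg_m]] := S_inc _ Su.
by exists m => //; rewrite /has_marker cr_m rg_m -surjective_pairing.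
Qed.

Lemma state_ext S S' : has_marker S =1 has_marker S' -> S = S'.
Proof.
move=> eqS; apply/val_inj/setP.
suff sub (T T' : state i) : has_marker T =1 has_marker T' ->
    forall u, u \in val T -> u \in val T'.
  by move=> u; apply/idP/idP; apply: sub => // d; rewrite eqS.
move=> eqT u Tu; case/and3P: (valP T) => /forall_inP/(_ _ Tu) + _ _.
case/existsP=> d /andP[/eqP cr_d /eqP rg_d]; move: (eqT d).
by rewrite /has_marker cr_d rg_d -surjective_pairing Tu => <-.
Qed.

Lemma transposition_moves j S S' a : transposition j S S' ->
  (exists d, [/\ sg d = j, cr d = cr a, has_marker S d & has_marker S' (ccw d)])
  \/ (forall d, cr d = cr a -> sg d <> j /\ has_marker S' d = has_marker S d).
Proof.
case/existsP=> d /and4P[/eqP sg_d /andP[Sd Sfd] /andP[S'd S'fd] /eqP eqS].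
(* The region [R1] at the end [d] is that of the corner [ccw d], so the marker turns by one corner;
   likewise at the other end. *)
have S'cd : has_marker S' (ccw d) by rewrite /has_marker cr_ccw rg_cwV.
have S'cfd : has_marker S' (ccw (flip d)).
  by rewrite /has_marker cr_ccw rg_cwV flipK.
have [eq1|neq1] := eqVneq (cr d) (cr a); first by left; exists d.
have [eq2|neq2] := eqVneq (cr (flip d)) (cr a).
  by left; exists (flip d); rewrite sg_flip.
right=> b cr_b; split=> [|].
  by rewrite -sg_d => /sgP[] e; rewrite -cr_b e eqxx in neq1 neq2.
move/setP/(_ (cr b, rg b)): eqS; rewrite !inE !xpair_eqE cr_b.
by rewrite !(eq_sym (cr a)) (negPf neq1) (negPf neq2) /= -cr_b.
Qed.

(* The heights at the crossing of the minimal marker [m], when the current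
   marker, having turned counterclockwise from [m], is [t] corners past it
   modulo full turns: the first [t] segments have been passed once more. *)
Definition height_profile h m t : Prop :=
  exists q, forall u, u < 4 -> h (sg (iter u ccw m)) = q + (u < t).

Definition local h : Prop := forall d, h (sg d) <= h (sg (cw d)) + min_marker i d.

Definition rises h d : bool := h (sg d) < h (sg (cw d)).

End States.

Section Heights.
Variables (K : diagram) (i : segment K).
Hypotheses (prime_K : prime_diagram K) (curls_K : without_curls K).
Variables (F : closedFieldType) (Phi : state i -> subspaces i F).
Hypothesis iso_Phi : state_module_iso Phi.
Implicit Types (S : state i) (d a m : K) (h : segment K -> nat) (e f : segment K).

Definition height S e : nat := \dim (Phi S e).

(** The minimal state is the one sent to the zero submodule; its uniqueness makes [min_marker] refer
    to a single state. *)
Lemma min_state_exists : exists S0,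
  (forall e, Phi S0 e = 0%VS) /\ forall d, min_marker i d = has_marker S0 d.
Proof.
have sub0 : submodule (fun e => 0%VS : {vspace spaceT i F e}).
  by move=> d _ v; rewrite !memv0 => /eqP->; rewrite mul0mx.
have [S0 S0E] := Phi_surjective iso_Phi sub0; exists S0; split=> // d.
have min0 : is_min S0.
  by apply/forallP=> S; apply/(Phi_le iso_Phi) => e; rewrite S0E sub0v.
apply/existsP/idP => [[S /andP[/forallP/(_ S0) le_S Sd]]|S0d]; last first.
  by exists S0; rewrite min0.
suff -> : S0 = S by [].
apply: (Phi_injective iso_Phi) => e; move/(Phi_le iso_Phi)/(_ e): le_S.
by rewrite S0E subv0 => /eqP->.
Qed.

Lemma height_transposition j S S' e : transposition j S S' ->
  height S' e = height S e + (e == j).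
Proof.
case/(Phi_transposition iso_Phi)=> _ off_j at_j; rewrite /height.
by case: eqP => [->|/off_j->]; rewrite ?addn0 ?addn1.
Qed.

(** Induction along transpositions from the minimal state, where all heights and [t] are 0. Turning
    the marker from corner [t] raises the segment numbered [t] by one; a full turn raises [q] and
    resets [t] to 0. *)
Lemma height_profileP S m t : min_marker i m -> t < 4 ->
  has_marker S (iter t ccw m) -> height_profile (height S) m t.
Proof.
have [S0 [S0E mmE]] := min_state_exists; rewrite mmE => S0m.
have: state_le S0 S by apply/(Phi_le iso_Phi) => e; rewrite S0E sub0v.
case/connectP=> p path_p eq_S.
have: forall t, t < 4 -> has_marker S0 (iter t ccw m) ->
    height_profile (height S0) m t.
  move=> {}t t4 S0t; exists 0 => u u4; rewrite /height S0E dimv0.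
  have /eqP := has_marker_inj prime_K curls_K S0t S0m (cr_iter_ccw t m).
  by rewrite (iter_ccw_inj m t4 (isT : 0 < 4)) => /eqP->.
elim: p S0 path_p eq_S t {S0E mmE S0m} => [|S1 p IHp] S0 /=.
  by move=> _ -> t prof; apply: prof.
case/andP=> /existsP[j tr] path_p eq_S t prof; apply: (IHp S1) => // {}t t4 S1t.
have htE := height_transposition _ tr.
have [[d [sg_d cr_d S0d S1d]]|fixed] := transposition_moves m tr; last first.
  have [_ eq_t] := fixed _ (cr_iter_ccw t m); rewrite eq_t in S1t.
  have [q qE] := prof _ t4 S1t; exists q => u u4; rewrite htE qE //.
  have [/eqP/negPf-> _] := fixed _ (cr_iter_ccw u m).
  by rewrite addn0.
have [s s4 dE] := cr_ccwP cr_d; rewrite dE in S0d S1d sg_d.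
have [q qE] := prof _ s4 S0d.
have {}htE u : u < 4 -> height S1 (sg (iter u ccw m)) = q + (u <= s).
  move=> u4; rewrite htE qE // -addnA; congr (_ + _).
  have -> : (sg (iter u ccw m) == j) = (u == s).
    rewrite -(iter_ccw_inj m u4 s4) -sg_d; apply/eqP/eqP => [|->//].
    by apply: sg_inj_at_crossing => //; rewrite !cr_iter_ccw.
  by case: (ltngtP u s).
have {S1t S1d} : iter t ccw m = ccw (iter s ccw m).
  apply: (has_marker_inj prime_K curls_K S1t S1d).
  by rewrite cr_ccw !cr_iter_ccw.
have [s3 eq_t|s3] := ltnP s 3.
  exists q => u u4; rewrite htE //.
  suff -> : t = s.+1 by rewrite ltnS.
  by apply/eqP; rewrite -(iter_ccw_inj m t4) // eq_t.
have {}s3 : s = 3 by apply/eqP; rewrite eqn_leq s3 -ltnS s4.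
rewrite s3 /= ccw4 => /eqP; rewrite (iter_ccw_inj m t4 (isT : 0 < 4)) => /eqP->.
by exists q.+1 => u u4; rewrite htE // s3 -ltnS u4 addn1 addn0.
Qed.

Lemma min_marker_inj d d' :
  min_marker i d -> min_marker i d' -> cr d = cr d' -> d = d'.
Proof. by have [S0 [_ mmE]] := min_state_exists; rewrite !mmE; apply: has_marker_inj. Qed.

Lemma min_marker_exists d : exists2 m, min_marker i m & exists2 n, n < 4 & d = iter n ccw m.
Proof.
have [S0 [_ mmE]] := min_state_exists.
have [m cr_m S0m] := has_marker_exists S0 d.
by exists m; rewrite ?mmE //; apply: cr_ccwP.
Qed.

(** The profile is nonincreasing in [u], which runs counterclockwise, so a clockwise drop occurs
    only from [u = 0] to [u = 3], across the minimal marker. *)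
Lemma height_local S : local i (height S).
Proof.
move=> d; have [m mm [n n4 ->]] := min_marker_exists d.
have [c cr_c Sc] := has_marker_exists S m.
have [t t4 cE] := cr_ccwP cr_c; rewrite {}cE in Sc.
have [q qE] := height_profileP mm t4 Sc.
case: n n4 => [_|n n4] /=.
  rewrite mm cw_ccw3 (qE 0 isT) (qE 3 isT) -addnA leq_add2l.
  exact: leq_trans (leq_b1 _) (leq_addl _ _).
rewrite ccwK (qE n.+1 n4) (qE n (ltnW n4)) -addnA leq_add2l.
by apply: leq_trans (leq_addr _ _); case: (ltnP n.+1 t) => // /ltnW->.
Qed.

(** The only clockwise rise of the profile is at corner [t], and there is none if [t = 0]. Hence
    heights determine the state, by the recipe of [stateS]. *)
Lemma has_markerE S c : has_marker S c = rises (height S) c ||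
  ([forall d, (cr d == cr c) ==> ~~ rises (height S) d] && min_marker i c).
Proof.
have [m mm [v v4 ->]] := min_marker_exists c.
have [a cr_a Sa] := has_marker_exists S m.
have [t t4 aE] := cr_ccwP cr_a; rewrite {}aE in Sa cr_a.
have [q qE] := height_profileP mm t4 Sa.
have t3 : (3 < t) = false by rewrite ltnNge -ltnS t4.
have rE u : u < 4 -> rises (height S) (iter u ccw m) = (0 < u) && (u == t).
  case: u => [_|u u4]; rewrite /rises /=.
    by rewrite cw_ccw3 (qE 0 isT) (qE 3 isT) ltn_add2l t3; case: (0 < t).
  rewrite ccwK (qE u.+1 u4) (qE u (ltnW u4)) ltn_add2l.
  by case: (ltngtP u.+1 t).
have -> : has_marker S (iter v ccw m) = (v == t).
  rewrite -(iter_ccw_inj m v4 t4); apply/idP/eqP => [Sv|-> //].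
  by apply: (has_marker_inj prime_K curls_K Sv Sa); rewrite !cr_iter_ccw.
have -> : min_marker i (iter v ccw m) = (v == 0).
  rewrite -(iter_ccw_inj m v4 (isT : 0 < 4)); apply/idP/eqP => [mv|-> //].
  by apply: min_marker_inj => //; rewrite cr_iter_ccw.
have -> : [forall d, (cr d == cr (iter v ccw m)) ==> ~~ rises (height S) d] = (t == 0).
  apply/forallP/eqP => [/(_ (iter t ccw m))|t0 d].
    by rewrite !cr_iter_ccw eqxx rE // eqxx andbT lt0n negbK => /eqP.
  apply/implyP; rewrite cr_iter_ccw => /eqP/cr_ccwP[u u4 ->].
  by rewrite rE // t0; case: u u4.
by rewrite rE //; move: v t {v4 t4 t3 Sa cr_a qE rE} => [|v] [|t]; rewrite /= ?andbT ?orbF.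
Qed.

Lemma height_inj S S' : height S =1 height S' -> S = S'.
Proof.
move=> eq_h; apply: state_ext => d; rewrite !has_markerE /rises !eq_h.
by congr (_ || (_ && _)); apply: eq_forallb => a; rewrite !eq_h.
Qed.

Lemma eq_stateS S j k : height S =1 level i j k -> val S = stateS i j k.
Proof.
move=> eq_h; apply/setP=> u; apply/idP/imsetP => [Su|[d]].
  case/and3P: (valP S) => /forall_inP/(_ _ Su)/existsP[d /andP[/eqP cr_d /eqP rg_d]] _ _.
  have uE : u = (cr d, rg d) by rewrite cr_d rg_d -surjective_pairing.
  exists d => //; move: Su; rewrite uE -/(has_marker S d) has_markerE inE.
  rewrite /rises /level_increases !eq_h => /orP[->//|/andP[/forallP no ->]].
  rewrite andbT; apply/orP; right; apply/forallP=> a.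
  by have := no a; rewrite !eq_h.
rewrite inE => Hd ->; rewrite -/(has_marker S d) has_markerE.
move: Hd; rewrite /rises /level_increases !eq_h => /orP[->//|/andP[/forallP no ->]].
rewrite andbT; apply/orP; right; apply/forallP=> a.
by have := no a; rewrite !eq_h.
Qed.

End Heights.

(** * Submodules of T(i) as local functions *)

Section InitialSpans.
Variables (F : fieldType) (n : nat).
Local Open Scope ring_scope.

Definition initial_span (k : nat) : {vspace 'rV[F]_n} :=
  <<[seq delta_mx 0%R m | m : 'I_n <- [seq m : 'I_n <- enum 'I_n | (m < k)%N]]>>%VS.

Lemma memv_initial_span k (v : 'rV[F]_n) :
  reflect (forall m : 'I_n, (k <= m)%N -> v 0 m = 0) (v \in initial_span k).
Proof.
apply: (iffP idP) => [v_in m le_m|v0].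
  have /coord_span-> : v \in <<in_tuple [seq delta_mx 0%R m |
    m : 'I_n <- [seq m : 'I_n <- enum 'I_n | (m < k)%N]]>>%VS by [].
  rewrite summxE big1 // => l _; rewrite mxE.
  have := mem_nth 0 (ltn_ord l); move: (nth _ _ _) => w.
  case/mapP=> a; rewrite mem_filter => /andP[lt_a _] ->.
  by rewrite mxE /= -val_eqE gtn_eqF ?mulr0 // (leq_trans lt_a).
rewrite (row_sum_delta v); apply: memv_suml => m _.
have [/v0->|lt_m] := leqP k m; first by rewrite scale0r mem0v.
by apply/memvZ/memv_span/map_f; rewrite mem_filter lt_m mem_enum.
Qed.

Lemma delta_initial_span k (m : 'I_n) :
  ((delta_mx 0 m : 'rV[F]_n) \in initial_span k) = (m < k)%N.
Proof.
apply/memv_initial_span/idP => [v0|lt_m l le_l]; last first.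
  by rewrite mxE /= -val_eqE gtn_eqF // (leq_trans lt_m).
by rewrite ltnNge; apply/negP=> /v0/eqP; rewrite mxE !eqxx oner_eq0.
Qed.

Lemma dim_initial_span k : (k <= n)%N -> \dim (initial_span k) = k.
Proof.
move=> le_k; pose delta (m : 'I_n) : 'rV[F]_n := delta_mx 0 m.
have: basis_of fullv [seq delta m | m <- enum 'I_n].
  rewrite basisEdim size_map size_enum_ord dimvf dim_matrix mul1r leqnn andbT.
  apply/subvP=> v _; rewrite (row_sum_delta v); apply: memv_suml => m _.
  by apply/memvZ/memv_span/map_f; rewrite mem_enum.
(* Up to order, the standard basis is the family with [m < k] followed by the rest, so that family
   is free. *)
move/basis_free; rewrite -(perm_free (perm_map delta
  (permEl (perm_filterC (fun m : 'I_n => (m < k)%N) (enum 'I_n))))) map_cat.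
move/catl_free/eqP=> ->; rewrite size_map size_filter -sum1_count big_enum_cond.
by rewrite /= -(big_ord_widen n (fun=> 1%N)) // sum1_card card_ord.
Qed.

Lemma initial_spanS k l : (k <= l)%N -> (initial_span k <= initial_span l)%VS.
Proof.
move=> le_kl; apply/subvP=> v /memv_initial_span v0.
by apply/memv_initial_span => m /(leq_trans le_kl)/v0.
Qed.

End InitialSpans.

Section Submodules.
Variables (K : diagram) (i : segment K).
Hypotheses (prime_K : prime_diagram K) (curls_K : without_curls K).
Variables (F : closedFieldType) (Phi : state i -> subspaces i F).
Hypothesis iso_Phi : state_module_iso Phi.
Implicit Types (S : state i) (d a m : K) (h : segment K -> nat) (e f : segment K).

Definition span_module h : subspaces i F := fun e => initial_span F (dimT i e) (h e).

Lemma height_le_dim S e : height Phi S e <= dimT i e.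
Proof. by have := dimvS (subvf (Phi S e)); rewrite dimvf dim_matrix mul1r. Qed.

Lemma max_state_exists : exists S1, forall e, height Phi S1 e = dimT i e.
Proof.
have subT : submodule (fun e => fullv : {vspace spaceT i F e}).
  by move=> d _ v _; rewrite memvf.
have [S1 S1E] := Phi_surjective iso_Phi subT; exists S1 => e.
by rewrite /height S1E dimvf dim_matrix mul1r.
Qed.

(** The dimensions are the heights of the state sent to all of T(i). *)
Lemma dim_local : local i (dimT i).
Proof.
have [S1 S1E] := max_state_exists.
by move=> d; have := height_local prime_K curls_K iso_Phi S1 d; rewrite !S1E.
Qed.

Lemma min_marker_iter d n : min_marker i d -> 0 < n < 4 -> ~~ min_marker i (iter n cw d).
Proof.
move=> mm /andP[n0 n4]; apply/negP=> mm'.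
have := min_marker_inj prime_K curls_K iso_Phi mm' mm (cr_iter n d).
have := cw_uniq d; case: n n0 n4 {mm'} => [|[|[|[|//]]]] //= _ _ + eq_n;
  by rewrite eq_n !inE eqxx ?orbT ?andbF.
Qed.

(** The other three corners carry no minimal marker, so going round through them from [cw d] to [d]
    never lowers [h]. *)
Lemma local_min_marker h d :
  local i h -> min_marker i d -> h (sg (cw d)) <= h (sg d).
Proof.
move=> loc mm; have step n : 0 < n < 4 -> h (sg (iter n cw d)) <= h (sg (iter n.+1 cw d)).
  move=> n04; have := loc (iter n cw d).
  by rewrite (negPf (min_marker_iter mm n04)) addn0.
rewrite -{2}(cw4 d); apply: leq_trans (step 1 isT) _.
exact: leq_trans (step 2 isT) (step 3 isT).
Qed.

(** Maps that keep the index occur only off minimal markers, where [h] does not drop; shifts lower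
    the index by one, which absorbs a drop of one. *)
Lemma span_module_submodule h :
  local i h -> submodule (span_module h).
Proof.
move=> loc d _ v /memv_initial_span v0; apply/memv_initial_span => l le_l.
have dim_loc := dim_local d; have := loc d.
rewrite mxE /phi; case: ifP => [id_case|_].
  have -> : min_marker i d = false.
    apply/negbTE/negP=> mm; move: id_case; rewrite mm andbF orbF => /eqP eq_dim.
    by have := local_min_marker dim_local mm; rewrite eq_dim ltnn.
  rewrite addn0 => le_h; apply: big1 => m _; rewrite mxE.
  by case: eqP => [eq_m|]; rewrite ?mulr0 // v0 ?mul0r // eq_m (leq_trans le_h).
case: ifP => _ le_h; last by apply: big1 => m _; rewrite mxE mulr0.
apply: big1 => m _; rewrite mxE; case: eqP => [eq_m|]; rewrite ?mulr0 //.
rewrite v0 ?mul0r // eq_m (leq_trans le_h) // -addn1 leq_add //.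
exact: leq_b1.
Qed.

Lemma state_of_local h : local i h -> (forall e, h e <= dimT i e) ->
  exists S, forall e, Phi S e = span_module h e.
Proof. by move=> loc le_h; apply/(Phi_surjective iso_Phi)/span_module_submodule. Qed.

Lemma state_of_height h : local i h -> (forall e, h e <= dimT i e) ->
  exists S, height Phi S =1 h.
Proof.
move=> loc le_h; have [S SE] := state_of_local loc le_h; exists S => e.
by rewrite /height SE; apply: dim_initial_span.
Qed.

(** The span module with the dimensions of [Phi S] comes from a state with the heights of [S], which
    must be [S]. *)
Lemma PhiE S e : Phi S e = span_module (height Phi S) e.
Proof.
have loc := height_local prime_K curls_K iso_Phi S.
have [S' S'E] := state_of_local loc (height_le_dim S).
rewrite -S'E; congr (Phi _ e); apply: (height_inj prime_K curls_K iso_Phi) => f.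
by rewrite [RHS]/height S'E dim_initial_span ?height_le_dim.
Qed.

Lemma state_leP S S' :
  state_le S S' <-> forall e, height Phi S e <= height Phi S' e.
Proof.
rewrite (Phi_le iso_Phi); split=> [le_S e|le_h e]; first exact: dimvS.
by rewrite !PhiE; apply: initial_spanS.
Qed.

(** The clockwise way from [e] to [f] passes at most three corners, of which at most one carries the
    minimal marker. *)
Lemma local_share_endpoint h e f :
  local i h -> share_endpoint e f -> h e <= (h f).+1.
Proof.
move=> loc /existsP[a /existsP[b /and3P[/eqP<- /eqP<- /eqP/esym/cr_iterP[n n4 ->]]]].
suff: h (sg a) <= h (sg (iter n cw a)) + has (min_marker i) (traject cw a n).
  by move/leq_trans; apply; rewrite -addn1 leq_add2l leq_b1.
elim: n a n4 => [|n IHn] a n4; first by rewrite addn0.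
rewrite iterSr /= (leq_trans (loc a)) //.
have := IHn (cw a) (ltnW n4).
case: (boolP (min_marker i a)) => mm; last by rewrite addn0.
suff -> : has (min_marker i) (traject cw (cw a) n) = false.
  by rewrite addn0 /= leq_add2r.
apply/hasPn => c /trajectP[t lt_t ->]; rewrite -iterSr.
by apply: min_marker_iter => //=; apply: leq_ltn_trans lt_t (ltnW n4).
Qed.

Lemma local_successor h e f : local i h -> successor i e f -> h e <= h f.
Proof.
move=> loc /existsP[a /existsP[[n n4] /and3P[/eqP<- /eqP<- /forallP no_mm]]] /=.
have {}no_mm l : l < n -> ~~ min_marker i (iter l cw a).
  by move=> ln; apply: no_mm (Ordinal ln).
elim: n {n4} no_mm => //= n IHn no_mm; apply: leq_trans (IHn _) _.
  by move=> l /ltnW; apply: no_mm.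
by have := loc (iter n cw a); rewrite (negPf (no_mm _ _)) ?addn0.
Qed.

End Submodules.

(** * Levels *)

Section Levels.
Variables (K : diagram) (i j : segment K).
Implicit Types (e f : segment K) (S T C : {set segment K}).

Lemma closure_in_sub T S : S \subset closure_in i T S.
Proof. by apply/bigcapsP=> C /andP[]. Qed.

Lemma closure_in_min T S C :
  closed_in i T C -> S \subset C -> closure_in i T S \subset C.
Proof. by move=> clC sub; apply: bigcap_inf; rewrite clC. Qed.

Lemma closed_inP T S : reflect
  (S \subset T /\ forall e f, e \in S -> f \in T -> successor i e f -> f \in S)
  (closed_in i T S).
Proof.
apply: (iffP andP) => -[sub cl]; split=> //.
  by move=> e f Se Tf; apply/implyP; move/forall_inP/(_ _ Se)/forall_inP: cl; apply.
by apply/forall_inP=> e Se; apply/forall_inP=> f Tf; apply/implyP; apply: cl.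
Qed.

Lemma closure_in_closed T S : S \subset T -> closed_in i T (closure_in i T S).
Proof.
move=> sub; have clT : closed_in i T T by apply/closed_inP.
apply/closed_inP; split=> [|e f /bigcapP Se Tf suc]; first exact: closure_in_min.
apply/bigcapP=> C /[dup] /Se Ce /andP[/closed_inP[_ clC] _].
exact: clC suc.
Qed.

Let layer n := (level_rec i j n).1.
Let layers n := (level_rec i j n).2.

Let frontier n : {set segment K} :=
  [set e in ~: layers n | [exists f in layer n, share_endpoint e f]].

Let layerS n : layer n.+1 = closure_in i (~: layers n) (frontier n).
Proof. by rewrite /frontier /layer /layers /=; case: (level_rec i j n). Qed.

Let layersS n : layers n.+1 = layers n :|: layer n.+1.
Proof. by rewrite /layer /layers /=; case: (level_rec i j n). Qed.

Let layerS_closed n : closed_in i (~: layers n) (layer n.+1).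
Proof.
by rewrite layerS; apply/closure_in_closed/subsetP => e; rewrite inE => /andP[].
Qed.

Let layers_mono m n e : m <= n -> e \in layers m -> e \in layers n.
Proof.
move=> /subnK <- me; elim: (n - m) => // p IHp.
by rewrite addSn layersS inE IHp.
Qed.

Let layer_layers m n e : m <= n -> e \in layer m -> e \in layers n.
Proof.
move/layers_mono=> mono me; apply: mono.
by case: m me => // m me; rewrite layersS inE me orbT.
Qed.

Let layer_notin m n e : n < m -> e \in layer m -> e \notin layers n.
Proof.
case: m => // m; rewrite ltnS => le_nm me.
have /closed_inP[/subsetP/(_ _ me)] := layerS_closed m.
by rewrite inE => + _; apply/contra/layers_mono.
Qed.

Let layersP n e : e \in layers n -> exists2 m, m <= n & e \in layer m.
Proof.
elim: n => [|n IHn]; first by exists 0.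
rewrite layersS inE => /orP[/IHn[m le_m me]|]; last by exists n.+1.
by exists m; rewrite // ltnW.
Qed.

(** A layer is closed only in the complement of the earlier ones, but a successor outside that
    complement already lies in an earlier layer. *)
Let layers_successor n e f : e \in layers n -> successor i e f -> f \in layers n.
Proof.
elim: n e => [|n IHn] e.
  have /closed_inP[_ cl] := closure_in_closed (subsetT [set j]).
  by move=> e0; apply: cl => //; rewrite inE.
rewrite layersS !inE => /orP[en /(IHn _ en)->//|en suc].
have [//|fn /=] := boolP (f \in layers n).
by have /closed_inP[_ cl] := layerS_closed n; apply: cl suc; rewrite // inE.
Qed.

Let layers_share n e f : f \in layers n -> share_endpoint e f -> e \in layers n.+1.
Proof.
case/layersP=> m le_mn fm sh; apply: (@layers_mono m.+1) => //.
rewrite layersS inE; have [//|em /=] := boolP (e \in layers m).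
rewrite layerS (subsetP (closure_in_sub _ _)) // !inE em.
by apply/exists_inP; exists f.
Qed.

(** Here [k > 0], so the layers and level 0 partition the segments: the choice made by [pick] is
    unique and the default in [level] is never reached. *)
Let level_geE k l e : 0 < l <= k -> (l <= level i j k e) = (e \in layers (k - l)).
Proof.
case/andP=> l0 lk; rewrite /level; case: pickP => [[d /= lt_d]|none].
  rewrite /level_set; case: eqP => [-> ek|/eqP d0 ed]; last first.
    apply/idP/idP => [le_ld|]; first by apply: layer_layers ed; rewrite leq_sub2l.
    apply: contraLR; rewrite -ltnNge => lt_dl; apply: layer_notin ed.
    by rewrite ltn_sub2l // (leq_trans lt_dl).
  rewrite leqNgt l0; apply/esym/negbTE; move: ek; rewrite inE; apply/contra.
  by apply: layers_mono; rewrite -subn1 leq_sub2l.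
have /layersP[m le_m em] : e \in layers k.-1.
  by have := none ord0; rewrite /level_set /= inE => /negbFE.
have k0 : 0 < k := leq_trans l0 lk.
have lt_mk : m < k by rewrite (leq_ltn_trans le_m) // ltn_predL.
have lt_km : k - m < k.+1 by rewrite ltnS leq_subr.
have := none (Ordinal lt_km); rewrite /level_set /= subn_eq0 leqNgt lt_mk /=.
by rewrite (subKn (ltnW lt_mk)); move: em; rewrite /layer => ->.
Qed.

Lemma level_le k e : level i j k e <= k.
Proof. by rewrite /level; case: pickP => // d _; rewrite -ltnS. Qed.

Lemma level_self k : 0 < k -> level i j k j = k.
Proof.
move=> k0; apply/eqP; rewrite eqn_leq level_le level_geE ?k0 //= subnn.
by apply: (subsetP (closure_in_sub _ _)); rewrite inE.
Qed.

(** Across a corner without minimal marker one reaches a successor, in the same union of layers;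
    across a minimal marker one reaches a neighbour, at most one layer later. *)
Lemma level_local k : local i (level i j k).
Proof.
move=> d; case le: (level i j k (sg d)) => [//|l].
have := level_le k (sg d); rewrite le => lk.
have: l.+1 <= level i j k (sg d) by rewrite le.
rewrite level_geE // => dU.
case mm: (min_marker i d); last first.
  rewrite addn0 level_geE //; apply: layers_successor dU _.
  apply/existsP; exists d; apply/existsP; exists (@Ordinal 4 1 isT).
  by rewrite /= !eqxx; apply/forallP=> -[[|//] _] /=; rewrite mm.
rewrite addn1 ltnS; case: l lk dU {le} => // l lk dU.
rewrite (level_geE _ (ltnW lk : 0 < l.+1 <= k)) -(subnSK lk) (layers_share dU) //.
by apply/existsP; exists (cw d); apply/existsP; exists d; rewrite !eqxx cr_cw /=.
Qed.

(** Lower bounds for [h] pass to successors, and drop by at most one on passing to neighbours; so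
    [h] is at least k - n on [layer n]. *)
Lemma level_min h k :
  (forall e f, successor i e f -> h e <= h f) ->
  (forall e f, share_endpoint e f -> h f <= (h e).+1) ->
  k <= h j -> forall e, level i j k e <= h e.
Proof.
move=> suc sh k_le e; case le: (level i j k e) => [//|l].
have := level_le k e; rewrite le => lk.
have: l.+1 <= level i j k e by rewrite le.
rewrite level_geE //.
suff sub n : layer n \subset [set f | k <= h f + n].
  case/layersP=> m le_m /(subsetP (sub m)); rewrite inE => k_m.
  rewrite -(leq_add2r (k - l.+1)) subnKC //.
  by apply: leq_trans k_m _; rewrite leq_add2l.
elim: n => [|n IHn].
  apply: closure_in_min; last by apply/subsetP=> f; rewrite !inE addn0 => /eqP->.
  apply/closed_inP; split=> [|f g]; first exact: subsetT.
  by rewrite !inE !addn0 => k_f _ /suc; apply: leq_trans.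
(* The comparison set is cut down to the complement in which the closure is taken. *)
rewrite layerS; apply: subset_trans (_ : [set f in ~: layers n | k <= h f + n.+1] \subset _).
  apply: closure_in_min.
    apply/closed_inP; split=> [|f g]; first by apply/subsetP=> f; rewrite inE => /andP[].
    rewrite !inE => /andP[_ k_f] -> /suc le_fg /=.
    by apply: leq_trans k_f _; rewrite leq_add2r.
  apply/subsetP=> f; rewrite !inE => /andP[-> /exists_inP[g gn /sh le_gf]] /=.
  move: (subsetP IHn _ gn); rewrite inE addnS -addSn => k_g.
  by apply: leq_trans k_g _; rewrite leq_add2r.
by apply/subsetP=> f; rewrite !inE => /andP[].
Qed.

End Levels.

(** * Join irreducible states *)

Section JoinIrreducibles.
Variables (K : diagram) (i : segment K).
Hypotheses (prime_K : prime_diagram K) (curls_K : without_curls K).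
Variables (F : closedFieldType) (Phi : state i -> subspaces i F).
Hypothesis iso_Phi : state_module_iso Phi.
Implicit Types (S : state i) (h : segment K -> nat) (e f j : segment K).

Let height_loc := height_local prime_K curls_K iso_Phi.
Let height_ext := height_inj prime_K curls_K iso_Phi.
Let leP := state_leP prime_K curls_K iso_Phi.

Lemma level_le_local h j k :
  local i h -> k <= h j -> forall e, level i j k e <= h e.
Proof.
move=> loc; apply: level_min => [e f|e f sh].
  exact: (local_successor loc).
apply: (local_share_endpoint prime_K curls_K iso_Phi loc).
case/existsP: sh => a /existsP[b /and3P[sg_a sg_b /eqP eq_cr]].
by apply/existsP; exists b; apply/existsP; exists a; rewrite sg_a sg_b eq_cr /=.
Qed.

(** The level function stays below the dimensions by minimality, as [dimT i] is local and at least
    [k] at [j]. *)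
Lemma level_state_exists j k : k <= dimT i j ->
  exists S, height Phi S =1 level i j k.
Proof.
move=> le_k; apply: (state_of_height prime_K curls_K iso_Phi).
  exact: level_local.
apply: level_le_local => //; exact: (dim_local prime_K curls_K iso_Phi).
Qed.

Lemma level_state_generated S j k : 0 < k <= dimT i j ->
  height Phi S =1 level i j k -> is_generated j k (Phi S).
Proof.
case/andP=> k0 le_k hS; split=> [|m lt_m|N subN gen_N e].
- exact: Phi_submodule.
- rewrite (PhiE prime_K curls_K iso_Phi) /span_module hS level_self //.
  by rewrite delta_initial_span.
have [T TE] := Phi_surjective iso_Phi subN; rewrite -TE.
apply: (Phi_le iso_Phi _ _).1 e; apply/leP => e; rewrite hS.
apply: level_le_local => //.
(* The vector b_(j,k) has index k - 1; containing it forces height at least [k] at [j]. *)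
have lt_k : k.-1 < dimT i j by rewrite prednK.
have := gen_N (Ordinal lt_k); rewrite /= prednK // leqnn => /(_ isT).
rewrite -TE (PhiE prime_K curls_K iso_Phi) /span_module delta_initial_span /=.
by rewrite prednK.
Qed.

Lemma is_join_height S1 S2 S :
  (forall e, height Phi S e = maxn (height Phi S1 e) (height Phi S2 e)) ->
  is_join S1 S2 S.
Proof.
move=> hS; split; try by apply/leP => e; rewrite hS ?leq_maxl ?leq_maxr.
by move=> T /leP le1 /leP le2; apply/leP => e; rewrite hS geq_max le1 le2.
Qed.

(** The pointwise maximum is local and bounded by the dimensions, hence the height of an upper
    bound, and the join lies below it. *)
Lemma join_height S1 S2 S : is_join S1 S2 S ->
  forall e, height Phi S e = maxn (height Phi S1 e) (height Phi S2 e).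
Proof.
case=> /leP le1 /leP le2 least.
pose h e := maxn (height Phi S1 e) (height Phi S2 e).
have loc_h : local i h.
  by move=> d; rewrite /h geq_max !addn_maxl !leq_max !height_loc ?orbT.
have [T hT] : exists T, height Phi T =1 h.
  apply: (state_of_height prime_K curls_K iso_Phi loc_h) => e.
  by rewrite geq_max !height_le_dim.
move=> e; apply/eqP; rewrite eqn_leq geq_max le1 le2 !andbT -/(h e) -hT.
suff /leP : state_le S T by apply.
by apply: least; apply/leP => f; rewrite hT ?leq_maxl ?leq_maxr.
Qed.

Lemma is_min_height S : is_min S = [forall e, height Phi S e == 0].
Proof.
apply/forallP/forallP => [min_S e|h0 T].
  have [S0 [S0E _]] := min_state_exists iso_Phi.
  by have /leP/(_ e) := min_S S0; rewrite /height S0E dimv0 leqn0.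
by apply/leP => e; rewrite (eqP (h0 e)).
Qed.

(** One of the two joined states has height [k] at [j]; by minimality it dominates the level
    function, so it is [S]. *)
Lemma level_state_irreducible S j k : 0 < k ->
  height Phi S =1 level i j k -> join_irreducible S.
Proof.
move=> k0 hS; split=> [|A B /[dup] /join_height hAB [/leP le_A /leP le_B _]].
  by rewrite is_min_height; apply/forallPn; exists j; rewrite hS level_self // -lt0n.
have eq_of C : (forall e, height Phi C e <= height Phi S e) ->
    k <= height Phi C j -> S = C.
  move=> le_C k_C; apply: height_ext => e; apply/eqP.
  by rewrite eqn_leq le_C andbT hS level_le_local.
have := hAB j; rewrite hS level_self // => kE.
by case: (leqP (height Phi B j) (height Phi A j)) kE => _ kE; [left|right];
  apply: eq_of; rewrite // -kE.
Qed.

(* A height function [h] is the maximum of the functions [level i e (h e)],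
   so irreducibility singles out one of them. *)
Lemma irreducible_level_state S : join_irreducible S ->
  exists j k, 0 < k <= dimT i j /\ height Phi S =1 level i j k.
Proof.
case=> not_min irr; pose h := height Phi S.
pose G (l : seq (segment K)) f := \max_(e <- l | 0 < h e) level i e (h e) f.
have le_G l f : G l f <= h f.
  by apply/bigmax_leqP_seq => e _ _; apply: level_le_local (height_loc S) _ _.
have loc_G l : local i (G l).
  move=> d; apply/bigmax_leqP_seq => e el he.
  apply: leq_trans (level_local _ _ _ _) _.
  by rewrite leq_add2r; apply: (leq_bigmax_seq (F := fun e => level i e (h e) _)).
have: h =1 G (index_enum (segment K)).
  move=> f; apply/eqP; rewrite eqn_leq le_G andbT.
  have [->//|hf] := posnP (h f).
  rewrite -{1}(level_self i f hf).
  by apply: (leq_bigmax_seq (F := fun e => level i e (h e) f)); rewrite ?mem_index_enum.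
(* Terms are split off one by one: [S] is the state of the first term or of the maximum of the rest.
   An empty maximum would make [S] minimal. *)
elim: (index_enum _) => [|e l IHl] hG.
  case/negP: not_min; rewrite is_min_height; apply/forallP=> f.
  by have := hG f; rewrite /G big_nil /h => ->.
have [he0|he] := posnP (h e).
  by apply: IHl => f; rewrite hG /G big_cons he0.
have le_he : h e <= dimT i e by apply: height_le_dim.
have [A hA] := level_state_exists le_he.
have [B hB] : exists B, height Phi B =1 G l.
  apply: (state_of_height prime_K curls_K iso_Phi) => // f.
  by apply: leq_trans (le_G _ _) _; apply: height_le_dim.
case: (irr A B) => [|SA|SB].
- by apply: is_join_height => f; rewrite -/(h f) hG /G big_cons he hA hB.
- by exists e, (h e); rewrite he le_he; split=> // f; rewrite -hA -SA.
- by apply: IHl => f; rewrite /h SB hB.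
Qed.

End JoinIrreducibles.

Theorem theorem5p8
  (R : realType) (n : nat) (gam : 'I_n -> R -> 'rV[R]_3)
  (K : diagram)
  (link_gam : link_embedding gam)
  (diagram_gam : is_diagram_of gam K)
  (prime_gam : prime_link (link_set gam))
  (prime_K : prime_diagram K)
  (curls_K : without_curls K)
  (i : segment K)
  (F : closedFieldType)
  (Phi : state i -> subspaces i F)
  (iso_Phi : state_module_iso Phi) :
  (forall S : {set crossing K * region K},
     (exists s : state i, val s = S /\ join_irreducible s) <->
     (exists (j : segment K) (k : nat),
        1 <= k <= dimT i j /\ S = stateS i j k)) /\
  (forall (j : segment K) (k : nat), 1 <= k <= dimT i j ->
     exists s : state i,
       val s = stateS i j k /\ is_generated j k (Phi s)).
Proof.
have valE s j k : height Phi s =1 level i j k -> val s = stateS i j k.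
  exact: eq_stateS.
split=> [S|j k le_k]; last first.
  have /andP[_ /(level_state_exists prime_K curls_K iso_Phi)[s hs]] := le_k.
  by exists s; split; [apply: valE | apply: level_state_generated].
split=> [[s [<- /(irreducible_level_state prime_K curls_K iso_Phi)]]|].
  by case=> j [k [le_k hs]]; exists j, k; split=> //; apply: valE.
case=> j [k [/andP[k0 /(level_state_exists prime_K curls_K iso_Phi)[s hs]] ->]].
exists s; split; first exact: valE.
exact: (level_state_irreducible prime_K curls_K iso_Phi k0 hs).
Qed.
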